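(* Let $X$ be a locally compact Hausdorff space and let $\overline{X}$ be a compactification of $X$. For $A\subseteq X$ put $tr(A)=cl_{\overline{X}}(A)\cap(\overline{X}\setminus X)$, let $\mathcal{B}_C$ be the bornology of all subsets of $X$ whose closure in $X$ is compact, and let ${\bf b}$ be the coarse proximity on $(X,\mathcal{B}_C)$ defined by $$A\,{\bf b}\,C\iff tr(A)\cap tr(C)\neq\emptyset \qquad (A,C\subseteq X).$$ Then the boundary $\mathcal{U}X$ of the coarse proximity space $(X,\mathcal{B}_C,{\bf b})$ is homeomorphic to $\overline{X}\setminus X$.
   Context: A compactification of $X$ is a compact Hausdorff space $\overline{X}$ containing $X$ as a dense subspace; $\overline X\setminus X$ carries the subspace topology. Coarse proximity spaces. A bornology $\mathcal{B}$ on a set $X$ is a family of subsets containing all singletons and closed under subsets and finite unions; its members are called bounded, other subsets unbounded. A coarse proximity on $(X,\mathcal{B})$ is a relation ${\bf b}$ on the power set of $X$ such that for all $A,B,C\subseteq X$: (1) $A{\bf b}B\Rightarrow B{\bf b}A$; (2) $A{\bf b}B\Rightarrow A,B\notin\mathcal{B}$; (3) $A\cap B\notin\mathcal{B}\Rightarrow A{\bf b}B$; (4) $(A\cup B){\bf b}C\iff A{\bf b}C$ or $B{\bf b}C$; (5) $A\bar{\bf b}B\Rightarrow\exists E\subseteq X$ with $A\bar{\bf b}E$ and $(X\setminus E)\bar{\bf b}B$ (a bar denotes negation). Then $(X,\mathcal{B},{\bf b})$ is a coarse proximity space. (The relation ${\bf b}$ in the claim is a coarse proximity.) Proximities and clusters.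 A proximity on a set $X$ is a relation $\delta$ on the power set with: (1) $A\delta B\Rightarrow B\delta A$; (2) $A\delta B\Rightarrow A,B\ne\emptyset$; (3) $A\cap B\neq\emptyset\Rightarrow A\delta B$; (4) $A\delta(B\cup C)\iff A\delta B$ or $A\delta C$; (5) $A\bar\delta B\Rightarrow\exists E\subseteq X$ with $A\bar\delta E$ and $(X\setminus E)\bar\delta B$. It is separated if $\{x\}\delta\{y\}\iff x=y$. It induces the topology in which $A$ is closed iff ($A\delta\{x\}\Rightarrow x\in A$). A cluster in $(X,\delta)$ is a collection $\sigma$ of subsets of $X$ such that: $A,B\in\sigma\Rightarrow A\delta B$; if $A\delta B$ for all $B\in\sigma$ then $A\in\sigma$; if $A\cup B\in\sigma$ then $A\in\sigma$ or $B\in\sigma$. For $\delta$ separated, the Smirnov compactification $\mathfrak{X}$ is the set of all clusters with the proximity $\mathcal{A}\delta^*\mathcal{C}$ iff $A\delta C$ for all $A,C\subseteq X$ such that $A\in\sigma$ for all $\sigma\in\mathcal{A}$ and $C\in\sigma$ for all $\sigma\in\mathcal{C}$; it is compact Hausdorff. Boundary. For a coarse proximity space $(X,\mathcal{B},{\bf b})$, the discrete extension is the separated proximity $A\delta_{dis}B\iff A\cap B\ne\emptyset$ or $A{\bf b}B$. The boundary $\mathcal{U}X$ is the set of clusters in $(X,\delta_{dis})$ containing no bounded set, with the subspace proximity and topology inherited from the Smirnov compactification $\mathfrak{X}$ of $(X,\delta_{dis})$. *)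

(* Defs.v *)
From HB Require Import structures.
From mathcomp Require Import all_boot all_order all_algebra.
From mathcomp Require Import all_classical.
From mathcomp Require Import topology.

Set Implicit Arguments.
Unset Strict Implicit.
Unset Printing Implicit Defensive.

Local Open Scope classical_set_scope.

Record bornology (X : Type) := Bornology {
  bounded_set :> set X -> Prop;
  bounded_set0 : bounded_set set0;
  bounded_set1 : forall x : X, bounded_set [set x];
  bounded_setS : forall A B : set X, A `<=` B -> bounded_set B -> bounded_set A;
  bounded_setU : forall A B : set X,
    bounded_set A -> bounded_set B -> bounded_set (A `|` B) }.

Record coarse_proximity (X : Type) (B : bornology X) := CoarseProximity {
  cprox :> set X -> set X -> Prop;
  cprox_sym : forall A C, cprox A C -> cprox C A;
  cprox_unbounded : forall A C, cprox A C -> ~ B A /\ ~ B C;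
  cprox_meet : forall A C, ~ B (A `&` C) -> cprox A C;
  cproxUl : forall A C D, cprox (A `|` C) D <-> cprox A D \/ cprox C D;
  cprox_normal : forall A C, ~ cprox A C ->
    exists E, ~ cprox A E /\ ~ cprox (~` E) C }.

Record proximity (X : Type) := Proximity {
  prox :> set X -> set X -> Prop;
  prox_sym : forall A B, prox A B -> prox B A;
  prox_nonempty : forall A B, prox A B -> A !=set0 /\ B !=set0;
  prox_meet : forall A B, A `&` B !=set0 -> prox A B;
  proxUr : forall A B C, prox A (B `|` C) <-> prox A B \/ prox A C;
  prox_normal : forall A B, ~ prox A B ->
    exists E, ~ prox A E /\ ~ prox (~` E) B }.

Definition separated_proximity (X : Type) (d : proximity X) :=
  forall x y : X, d [set x] [set y] <-> x = y.

Lemma proxS (X : Type) (d : proximity X) (A B A' B' : set X) :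
  A `<=` A' -> B `<=` B' -> d A B -> d A' B'.
Proof.
move=> /setUidr eA /setUidr eB dAB.
by rewrite -eB proxUr; left; apply: prox_sym; rewrite -eA proxUr; left;
  apply: prox_sym.
Qed.

Lemma cproxS (X : Type) (B : bornology X) (b : coarse_proximity B)
    (A C A' C' : set X) :
  A `<=` A' -> C `<=` C' -> b A C -> b A' C'.
Proof.
move=> /setUidr eA /setUidr eC bAC.
by rewrite -eA cproxUl; left; apply: cprox_sym; rewrite -eC cproxUl; left;
  apply: cprox_sym.
Qed.

Definition prox_closed (X : Type) (d : proximity X) (A : set X) :=
  forall x, d A [set x] -> A x.

(* X with the topology induced by the proximity d *)
Definition prox_space (X : Type) (d : proximity X) : Type := X.

Section ProxTopology.
Variables (X : Type) (d : proximity X).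

Definition prox_open : set (set X) := [set U | prox_closed d (~` U)].

Lemma prox_openT : prox_open setT.
Proof. by move=> x; rewrite setCT => /prox_nonempty[[? []]]. Qed.

Lemma prox_openI : setI_closed prox_open.
Proof.
move=> U V oU oV x /prox_sym; rewrite setCI proxUr.
by case=> /prox_sym; [move/oU; left|move/oV; right].
Qed.

Lemma prox_open_bigcup (I : Type) (f : I -> set X) :
  (forall i, prox_open (f i)) -> prox_open (\bigcup_i f i).
Proof.
move=> of_ x dx [i _ fix_]; apply: (of_ i x) fix_.
by apply: proxS dx => // y ny fy; apply: ny; exists i.
Qed.

HB.instance Definition _ := gen_eqMixin (prox_space d).
HB.instance Definition _ := gen_choiceMixin (prox_space d).
HB.instance Definition _ := isOpenTopological.Build (prox_space d)
  prox_openT prox_openI prox_open_bigcup.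

Lemma prox_closedE (A : set (prox_space d)) : closed A <-> prox_closed d A.
Proof. by rewrite -openC -{2}[A]setCK. Qed.

End ProxTopology.

Record is_prox_cluster (X : Type) (d : proximity X) (s : set X -> Prop) : Prop :=
  IsProxCluster {
    prox_cluster_near : forall A B, s A -> s B -> d A B;
    prox_cluster_max : forall A, (forall B, s B -> d A B) -> s A;
    prox_cluster_split : forall A B, s (A `|` B) -> s A \/ s B }.

Record prox_cluster (X : Type) (d : proximity X) := ProxCluster {
  cluster_mem :> set X -> Prop;
  prox_clusterP : is_prox_cluster d cluster_mem }.

Section Smirnov.
Variables (X : Type) (d : proximity X).
Implicit Types (s : prox_cluster d) (S T R : set (prox_cluster d)).

Definition smirnov_near S T := forall A C : set X,
  (forall s, S s -> s A) -> (forall s, T s -> s C) -> d A C.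

Let cl_nonempty s A : s A -> A !=set0.
Proof.
by move=> sA; have /prox_nonempty[] := prox_cluster_near (prox_clusterP s) sA sA.
Qed.

Let cl_setT s : s setT.
Proof.
apply: (prox_cluster_max (prox_clusterP s)) => B /cl_nonempty[x Bx].
by apply: prox_meet; exists x.
Qed.

Let cl_far s A E : s A -> ~ d A E -> s (~` E).
Proof.
move=> sA dAE; have := cl_setT s; rewrite -(setUv E).
case/(prox_cluster_split (prox_clusterP s)) => // sE.
by case: dAE; exact: (prox_cluster_near (prox_clusterP s)).
Qed.

Let cl_sub s A B : A `<=` B -> s A -> s B.
Proof.
move=> AB sA; apply: (prox_cluster_max (prox_clusterP s)) => C sC.
by apply: (proxS AB (@subset_refl _ C)); exact: (prox_cluster_near (prox_clusterP s)).
Qed.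

Let far_ex S T : ~ smirnov_near S T ->
  exists A C, [/\ forall s, S s -> s A, forall s, T s -> s C & ~ d A C].
Proof.
move=> nST; apply: contrapT => H; apply: nST => A C SA TC.
by apply: contrapT => nd; apply: H; exists A, C.
Qed.

Lemma smirnov_sym S T : smirnov_near S T -> smirnov_near T S.
Proof. by move=> ST A C TA SC; apply: prox_sym; exact: ST. Qed.

Lemma smirnov_nonempty S T : smirnov_near S T -> S !=set0 /\ T !=set0.
Proof.
have key S' T' : smirnov_near S' T' -> S' !=set0.
  move=> ST; apply: contrapT => S0.
  have /prox_nonempty[[]//] : d set0 setT.
  by apply: ST => s Ss //; case: S0; exists s.
by move=> ST; split; [exact: key ST|exact: (key _ _ (smirnov_sym ST))].
Qed.

Lemma smirnov_meet S T : S `&` T !=set0 -> smirnov_near S T.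
Proof.
case=> s [Ss Ts] A C SA TC.
by apply: (prox_cluster_near (prox_clusterP s)); [exact: SA|exact: TC].
Qed.

Lemma smirnovUr S T R :
  smirnov_near S (T `|` R) <-> smirnov_near S T \/ smirnov_near S R.
Proof.
split; last first.
  by case=> SN A C SA TC; apply: SN => // s sT; apply: TC; [left|right].
move=> STR; apply: contrapT => /not_orP[/far_ex[A1 [C1 [SA1 TC1 d1]]]].
move=> /far_ex[A2 [C2 [SA2 RC2 d2]]].
have [E1 [dE1 dC1]] := prox_normal d1.
have [E2 [dE2 dC2]] := prox_normal d2.
have : d (~` (E1 `|` E2)) (C1 `|` C2).
  apply: STR => s.
    move=> Ss; have := cl_setT s; rewrite -(setUv (E1 `|` E2)).
    case/(prox_cluster_split (prox_clusterP s)) => //.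
    have near := prox_cluster_near (prox_clusterP s).
    case/(prox_cluster_split (prox_clusterP s)) => sE.
      by case: dE1; apply: near => //; exact: SA1.
    by case: dE2; apply: near => //; exact: SA2.
  case=> [/TC1|/RC2] sC.
    by apply: cl_sub sC; exact: subsetUl.
  by apply: cl_sub sC; exact: subsetUr.
rewrite proxUr => -[] h.
  by apply: dC1; apply: proxS h => // x nE Ex; apply: nE; left.
by apply: dC2; apply: proxS h => // x nE Ex; apply: nE; right.
Qed.

Lemma smirnov_normal S T : ~ smirnov_near S T ->
  exists R, ~ smirnov_near S R /\ ~ smirnov_near (~` R) T.
Proof.
move=> /far_ex[A [C [SA TC dAC]]].
have [E [dAE dEC]] := prox_normal dAC.
exists [set s | s E]; split => [/(_ A E SA)|]; first by move=> h; apply: dAE; exact: h.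
move=> /(_ (~` E) C) h; apply: dEC; apply: h => // s /= nsE.
have := cl_setT s; rewrite -(setUv E).
by case/(prox_cluster_split (prox_clusterP s)).
Qed.

Definition smirnov_proximity : proximity (prox_cluster d) :=
  Proximity smirnov_sym smirnov_nonempty smirnov_meet smirnovUr smirnov_normal.

End Smirnov.

Section DiscreteExtension.
Variables (X : Type) (B : bornology X) (b : coarse_proximity B).

Definition discrete_near (A C : set X) := A `&` C !=set0 \/ b A C.

Lemma discrete_near_sym A C : discrete_near A C -> discrete_near C A.
Proof. by case=> [|/cprox_sym]; [rewrite setIC; left|right]. Qed.

Lemma discrete_near_nonempty A C :
  discrete_near A C -> A !=set0 /\ C !=set0.
Proof.
case=> [[x [Ax Cx]]|/cprox_unbounded[nA nC]]; first by split; exists x.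
by split; apply/set0P/eqP => e;
  [apply: nA|apply: nC]; rewrite e; exact: bounded_set0.
Qed.

Lemma discrete_near_meet A C : A `&` C !=set0 -> discrete_near A C.
Proof. by left. Qed.

Lemma discrete_nearUr A C D :
  discrete_near A (C `|` D) <-> discrete_near A C \/ discrete_near A D.
Proof.
split.
  case=> [[x [Ax [Cx|Dx]]]|/cprox_sym]; first by left; left; exists x.
    by right; left; exists x.
  by rewrite cproxUl => -[]/cprox_sym; [left|right]; right.
case=> -[[x [Ax Cx]]|h].
- by left; exists x; split => //; left.
- by right; apply: cproxS h => //; exact: subsetUl.
- by left; exists x; split => //; right.
- by right; apply: cproxS h => //; exact: subsetUr.
Qed.

Lemma discrete_near_normal A C : ~ discrete_near A C ->
  exists E, ~ discrete_near A E /\ ~ discrete_near (~` E) C.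
Proof.
move=> /not_orP[nI nb]; have [E [nAE nEC]] := cprox_normal nb.
exists ((E `\` A) `|` C); split; apply/not_orP; split.
- by case=> x [Ax [[_ /(_ Ax)]//|Cx]]; apply: nI; exists x.
- move=> h; have : b (C `|` E) A.
    apply: cprox_sym; apply: cproxS h => // x [[Ex _]|Cx]; [by right|by left].
  by rewrite cproxUl => -[] /cprox_sym.
- by case=> x [nx Cx]; apply: nx; right.
- move=> h; have : b (~` E `|` A) C.
    apply: cproxS h => // x nx; have [Ax|nAx] := pselect (A x); first by right.
    by left=> Ex; apply: nx; left.
  by rewrite cproxUl => -[].
Qed.

Definition discrete_extension : proximity X :=
  Proximity discrete_near_sym discrete_near_nonempty discrete_near_meet
    discrete_nearUr discrete_near_normal.

Lemma discrete_extension_separated : separated_proximity discrete_extension.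
Proof.
move=> x y; split => [|->]; last by left; exists y.
case=> [[z [/= -> ->]]//|/cprox_unbounded[nx _]].
by case: nx; exact: bounded_set1.
Qed.

Definition coarse_boundary :
    set (prox_space (smirnov_proximity discrete_extension)) :=
  [set s : prox_cluster discrete_extension | forall A, s A -> ~ B A].

End DiscreteExtension.

Arguments coarse_boundary {X B} b.

Definition homeomorphic (S T : topologicalType) :=
  exists (f : S -> T) (g : T -> S),
    [/\ cancel f g, cancel g f, continuous f & continuous g].

Section Compactification.
Variables (X Xbar : topologicalType) (i : X -> Xbar).

(* X is identified with the subspace range i of Xbar *)
Definition is_compactification :=
  [/\ compact [set: Xbar], hausdorff_space Xbar, injective i,
      (forall U : set X, open U <-> exists2 V, open V & i @^-1` V = U) &
      dense (range i)].

Definition trace (A : set X) : set Xbar := closure (i @` A) `&` ~` range i.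

Definition trace_near (A C : set X) := trace A `&` trace C !=set0.

End Compactification.

Section CompactClosureBornology.
Variables (X : topologicalType) (hX : hausdorff_space X).

Definition compact_closure : set (set X) := [set A | compact (closure A)].

Lemma compact_closure0 : compact_closure set0.
Proof. by rewrite /compact_closure /= closure0; exact: compact0. Qed.

Lemma compact_closure1 (x : X) : compact_closure [set x].
Proof.
rewrite /compact_closure /=; have /closure_id <- : closed [set x].
  by apply: accessible_closed_set1; exact: hausdorff_accessible.
exact: compact_set1.
Qed.

Lemma compact_closureS (A B : set X) :
  A `<=` B -> compact_closure B -> compact_closure A.
Proof.
move=> AB cB; apply: subclosed_compact cB _; first exact: closed_closure.
exact: closureS.
Qed.

Lemma compact_closureU (A B : set X) :
  compact_closure A -> compact_closure B -> compact_closure (A `|` B).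
Proof. by rewrite /compact_closure /= closureU => cA cB; exact: compactU. Qed.

Definition compact_closure_bornology : bornology X :=
  Bornology compact_closure0 compact_closure1 compact_closureS compact_closureU.

End CompactClosureBornology.

Section TraceProximity.
Variables (X Xbar : topologicalType) (i : X -> Xbar).
Hypotheses (lcX : locally_compact [set: X]) (hX : hausdorff_space X).
Hypothesis ci : is_compactification i.

Let cpt : compact [set: Xbar]. Proof. by case: ci. Qed.
Let hXb : hausdorff_space Xbar. Proof. by case: ci. Qed.
Let emb (U : set X) : open U <-> exists2 V, open V & i @^-1` V = U.
Proof. by case: ci. Qed.

Let icont : continuous i.
Proof. by apply/continuousP => V oV; apply/emb; exists V. Qed.

Let open_range : open (range i).
Proof.
rewrite openE => _ [x _ <-].
have [K xK [cK _]] := lcX (I : [set: X] x).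
rewrite withinET in xK.
move: xK; rewrite nbhsE => -[U [oU Ux] UK].
have [V oV VU] := (emb U).1 oU.
have ciK : closed (i @` K).
  apply: compact_closed => //; apply: continuous_compact => //.
  exact: continuous_subspaceT.
have VK : V `<=` i @` K.
  move=> y Vy; apply: contrapT => nKy.
  have dX : dense (range i) by case: ci.
  have [||z [[Vz nKz] [w _ wz]]] := dX (V `&` ~` (i @` K)).
  - by exists y.
  - by apply: openI => //; rewrite openC.
  - by apply: nKz; exists w => //; apply: UK; rewrite -VU /preimage /= wz.
apply: (@filterS _ _ _ V); first by move=> y /VK[w _ <-]; exists w.
by apply: open_nbhs_nbhs; split => //; rewrite -VU in Ux.
Qed.

Let closed_trace A : closed (trace i A).
Proof. by apply: closedI; [exact: closed_closure|rewrite closedC]. Qed.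

Let trace_bounded A : compact_closure A -> trace i A = set0.
Proof.
move=> cA; rewrite -subset0 => y [cy []].
have : closed (i @` closure A).
  apply: compact_closed => //; apply: continuous_compact => //.
  exact: continuous_subspaceT.
move/closure_id => e.
have : (i @` closure A) y.
  rewrite e; apply: closureS cy; apply: image_subset; exact: subset_closure.
by case=> x _ <-; exists x.
Qed.

Let compact_preimage D : compact D -> D `<=` range i -> compact (i @^-1` D).
Proof.
move=> cD Di F PF FD.
have [y [Dy cy]] := cD (i @ F) _ FD.
have [x _ xy] := Di _ Dy; exists x; split; first by rewrite /= xy.
move=> A N FA; rewrite nbhsE => -[U [oU Ux] UN].
have [V oV VU] := (emb U).1 oU.
have [||_ [[z Az <-] Vz]] := cy (i @` A) V.
- by rewrite /= nbhs_simpl; apply: filterS FA; exact: preimage_image.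
- by apply: open_nbhs_nbhs; split => //; rewrite -xy -[V _]/((i @^-1` V) x) VU.
by exists z; split => //; apply: UN; rewrite -VU.
Qed.

Let trace0_bounded A : trace i A = set0 -> compact_closure A.
Proof.
move=> tA0.
have sub : closure (i @` A) `<=` range i.
  move=> y cy; apply: contrapT => ny.
  by have : trace i A y by []; rewrite tA0.
apply: (@subclosed_compact _ _ (i @^-1` closure (i @` A))).
- exact: closed_closure.
- apply: compact_preimage => //.
  by apply: subclosed_compact cpt _ => //; exact: closed_closure.
- have cl : closed (i @^-1` closure (i @` A)).
    apply: preimage_closed; last exact: closed_closure.
    by move=> x _; exact: icont.
  move/closure_id: cl => ->; apply: closureS => x Ax /=.
  by apply: subset_closure; exists x.
Qed.

Let traceU A C : trace i (A `|` C) = trace i A `|` trace i C.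
Proof. by rewrite /trace image_setU closureU setIUl. Qed.

Let traceS A C : A `<=` C -> trace i A `<=` trace i C.
Proof. by move=> AC y [cy ny]; split => //; apply: closureS cy; exact: image_subset. Qed.

Lemma trace_near_sym A C : trace_near i A C -> trace_near i C A.
Proof. by rewrite /trace_near setIC. Qed.

Lemma trace_near_unbounded A C : trace_near i A C ->
  ~ compact_closure_bornology hX A /\ ~ compact_closure_bornology hX C.
Proof.
by case=> y [yA yC]; split => /trace_bounded e; [move: yA|move: yC]; rewrite e.
Qed.

Lemma trace_near_meet A C :
  ~ compact_closure_bornology hX (A `&` C) -> trace_near i A C.
Proof.
move=> nb; have [e|/eqP/set0P[y ty]] := pselect (trace i (A `&` C) = set0).
  by case: nb; exact: trace0_bounded.
by exists y; split; apply: traceS ty => x [].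
Qed.

Lemma trace_nearUl A C D :
  trace_near i (A `|` C) D <-> trace_near i A D \/ trace_near i C D.
Proof.
rewrite /trace_near traceU setIUl; split.
  by case=> y [h|h]; [left|right]; exists y.
by case=> -[y h]; exists y; [left|right].
Qed.

Lemma trace_near_normal A C : ~ trace_near i A C ->
  exists E, ~ trace_near i A E /\ ~ trace_near i (~` E) C.
Proof.
move=> nAC.
have sub : trace i C `<=` ~` trace i A by move=> y Cy Ay; apply: nAC; exists y.
have nA : set_nbhs (trace i C) (~` trace i A).
  apply/set_nbhsP; exists (~` trace i A); split => //.
  by rewrite openC; exact: closed_trace.
have [U nU cU] := compact_normal hXb cpt (@closed_trace C) nA.
move/set_nbhsP: nU => [V [oV CV VU]].
exists (i @^-1` V); split.
  case=> y [Ay [cy _]]; apply: (cU y) Ay; apply: closureS cy => _ [x Vx <-].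
  exact: VU.
case=> y [[cy _] Cy].
have /closure_id e : closed (~` V) by rewrite closedC.
have : (~` V) y by rewrite e; apply: closureS cy => _ [x nVx <-].
by apply; exact: CV.
Qed.

Definition trace_coarse_proximity :
    coarse_proximity (compact_closure_bornology hX) :=
  CoarseProximity trace_near_sym trace_near_unbounded trace_near_meet
    trace_nearUl trace_near_normal.

End TraceProximity.

(* Main.v *)
Require Import Defs.
From mathcomp Require Import all_boot all_classical topology.

(** Write [∂] for the remainder [~` range i].  A point [p] of [∂] determines the
family [sigma_p] of all [A] with [p] in [trace i A].  It is a cluster: two of
its members have traces meeting at [p], and a set near every member is near the
preimages of all small neighbourhoods of [p], so that regularity of [Xbar] puts
[p] in its closure ([closure_of_near_preimages]).

Conversely every cluster [s] without bounded members is some [sigma_p].  The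
subsets of [Xbar] whose complement pulls back outside [s] form a proper filter,
and a cluster point [p] of this filter has the property that all its
neighbourhoods pull back into [s] ([cluster_limit]).  Local compactness keeps
[p] out of [X], since a point of [X] has a neighbourhood with bounded preimage.
The regularity argument above then gives that [s] is contained in [sigma_p],
and by maximality a cluster contained in another one is equal to it
([boundary_clusterE]).

The bijection [p |-> sigma_p] is compared with the topology of the Smirnov
compactification through the sets of all clusters having a prescribed member,
which are closed ([closed_cluster_mem]).  For a closed [K] in [Xbar], the
clusters [sigma_p] with [p] in [K] are those containing the preimage of every
open [V] including [K], hence form a closed set.  In the other direction, if [p]
lies in the closure of a set [S] of points of [∂], then [sigma_p] is near
[{sigma_q | q in S}], because a set whose trace includes [S] also has [p] in its
trace. *)

Local Open Scope classical_set_scope.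

(** * Clusters of a proximity *)

Lemma clusterS (X : Type) (d : proximity X) (s : prox_cluster d)
    (A B : set X) : A `<=` B -> s A -> s B.
Proof.
move=> AB sA; apply: (prox_cluster_max (prox_clusterP s)) => C sC.
by apply: (proxS AB (@subset_refl _ C)); exact: (prox_cluster_near (prox_clusterP s)).
Qed.

Lemma cluster_neq0 (X : Type) (d : proximity X) (s : prox_cluster d)
    (A : set X) : s A -> A !=set0.
Proof.
by move=> sA; have /prox_nonempty[] := prox_cluster_near (prox_clusterP s) sA sA.
Qed.

Lemma clusterT (X : Type) (d : proximity X) (s : prox_cluster d) : s setT.
Proof.
apply: (prox_cluster_max (prox_clusterP s)) => B /cluster_neq0[x Bx].
by apply: prox_meet; exists x.
Qed.

Lemma prox_cluster_ext (X : Type) (d : proximity X) (s t : prox_cluster d) :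
  (forall A, s A <-> t A) -> s = t.
Proof.
case: s t => [s sP] [t tP] /= st.
have e : s = t by apply/funext => A; apply/propext.
by move: tP; rewrite -e => tP; congr ProxCluster; exact: Prop_irrelevance.
Qed.

(** A member of [t] is near all members of [t], hence near all those of [s], and
maximality of [s] applies. *)
Lemma prox_cluster_subset_eq (X : Type) (d : proximity X) (s t : prox_cluster d) :
  (forall A, s A -> t A) -> s = t.
Proof.
move=> st; apply: prox_cluster_ext => A; split => [/st//|tA].
apply: (prox_cluster_max (prox_clusterP s)) => B /st.
exact: (prox_cluster_near (prox_clusterP t)).
Qed.

(** [A] is one of the sets tested by [smirnov_near], so a cluster near this
family has all its members near [A]. *)
Lemma closed_cluster_mem (X : Type) (d : proximity X) (A : set X) :
  closed ([set s : prox_cluster d | s A] :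
    set (prox_space (smirnov_proximity d))).
Proof.
apply/prox_closedE => s /= near_s.
apply: (prox_cluster_max (prox_clusterP s)) => C sC.
by apply: near_s => // _ ->.
Qed.

(** * Neighbourhoods in a compactification *)

Section Compactification.
Context {X Xbar : topologicalType} {i : X -> Xbar}.
Hypothesis ci : is_compactification i.

Lemma compactification_separate (p : Xbar) (U : set Xbar) : nbhs p U ->
  exists V, [/\ open V, V p & closure V `<=` U].
Proof.
have [cpt hXb _ _ _] := ci.
move=> /(compact_regular hXb cpt filterT)[V].
rewrite nbhsE => -[W [oW Wp] WV] VU; exists W; split => //.
exact: subset_trans (closureS WV) VU.
Qed.

Lemma nbhs_closure_preimage (p : Xbar) (V : set Xbar) :
  nbhs p V -> closure (i @` (i @^-1` V)) p.
Proof.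
have [_ _ _ _ dX] := ci.
move=> Vp N Np; have : nbhs p (V `&` N) by exact: filterI.
rewrite nbhsE => -[W [oW Wp] WVN].
have [||y [Wy [x _ xy]]] := dX W => //; first by exists p.
have [Vy Ny] := WVN _ Wy.
by exists y; split => //; exists x => //=; rewrite xy.
Qed.

Lemma closure_preimage_subset (V : set Xbar) :
  closure (i @` (i @^-1` V)) `<=` closure V.
Proof. by apply: closureS => _ [x Vx <-]. Qed.

(** Two sets near each other have intersecting closures in [Xbar], whichever of
the two clauses of the discrete extension makes them near; disjoint closed
neighbourhoods of [p] and of the closure of [A] would contradict this. *)
Lemma closure_of_near_preimages (p : Xbar) (A : set X) :
  (forall V, open V -> V p ->
     A `&` (i @^-1` V) !=set0 \/ trace_near i A (i @^-1` V)) ->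
  closure (i @` A) p.
Proof.
move=> near; apply: contrapT => nAp.
have [|V [oV Vp VA]] := @compactification_separate p (~` closure (i @` A)).
  apply: open_nbhs_nbhs; split => //.
  by rewrite openC; exact: closed_closure.
case: (near V oV Vp) => [[x [Ax Vx]]|[y [[Ay _] [/closure_preimage_subset Vy _]]]].
  by apply: (VA (i x)); apply: subset_closure => //; exists x.
exact: (VA y).
Qed.

(** By regularity a closed set is the intersection of the closures of its open
neighbourhoods, and by density [X] meets such a neighbourhood in a dense subset
of it. *)
Lemma closed_mem_preimages (K : set Xbar) (p : Xbar) : closed K ->
  (forall V, open V -> K `<=` V -> closure (i @` (i @^-1` V)) p) -> K p.
Proof.
move=> cK nearK; apply: contrapT => nKp.
have [|V [oV Vp VK]] := @compactification_separate p (~` K).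
  by apply: open_nbhs_nbhs; split => //; rewrite openC.
have [|||y [[x nVx <-] Vx]] := nearK (~` closure V) _ _ V.
- by rewrite openC; exact: closed_closure.
- by move=> y Ky Vy; exact: (VK y).
- by apply: open_nbhs_nbhs; split.
by apply: nVx; exact: subset_closure.
Qed.

(** The filter of all [S] with [i @^-1` (~` S)] outside [s] is closed under
intersection by the splitting property of clusters; any of its cluster points
is a limit, because a neighbourhood [V] of it cannot miss [~` V]. *)
Lemma cluster_limit (d : proximity X) (s : prox_cluster d) :
  exists p : Xbar, forall V, nbhs p V -> s (i @^-1` V).
Proof.
have [cpt _ _ _ _] := ci.
pose F : set_system Xbar := [set S | ~ s (i @^-1` (~` S))].
have FF : ProperFilter F.
  split; first by rewrite /F /= setC0 preimage_setT; apply; exact: clusterT.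
  split.
  - by rewrite /F /= setCT preimage_set0 => /cluster_neq0[].
  - move=> S T FS FT; rewrite /F /= setCI preimage_setU.
    by case/(prox_cluster_split (prox_clusterP s)).
  - move=> S T ST FS sT; apply: FS; apply: clusterS sT => x nT /ST; exact: nT.
have [|p [_ clp]] := cpt F FF; first exact: filterT.
exists p => V Vp; apply: contrapT => nsV.
have [|y [nVy Vy]] := clp (~` V) V _ Vp; first by rewrite /F /= setCK.
exact: nVy.
Qed.

(** * The boundary as the remainder *)

Hypotheses (lcX : locally_compact [set: X]) (hX : hausdorff_space X).

Let b := trace_coarse_proximity lcX hX ci.
Let d := discrete_extension b.

Lemma bounded_nbhs (x : X) :
  exists2 V, nbhs (i x) V & compact_closure (i @^-1` V).
Proof.
have [_ _ _ emb _] := ci.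
have [K xK [cK _]] := lcX x I.
rewrite withinET in xK; move: xK; rewrite nbhsE => -[U [oU Ux] UK].
have [V oV VU] := (emb U).1 oU; exists V.
  by apply: open_nbhs_nbhs; split => //; rewrite -VU in Ux.
rewrite VU; apply: compact_closureS UK _; rewrite /compact_closure /=.
by have /closure_id <- : closed K by exact: compact_closed.
Qed.

Lemma trace_prox_cluster (p : Xbar) : (~` range i) p ->
  is_prox_cluster d (fun A => trace i A p).
Proof.
move=> np; split.
- by move=> A C Ap Cp; right; exists p.
- move=> A near; split => //; apply: closure_of_near_preimages => V oV Vp.
  apply: (near (i @^-1` V)); split => //.
  by apply: nbhs_closure_preimage; exact: open_nbhs_nbhs.
- by move=> A C; rewrite /trace image_setU closureU => -[[Ap|Cp] _]; [left|right].
Qed.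

Definition trace_cluster (p : Xbar) (np : (~` range i) p) : prox_cluster d :=
  ProxCluster (trace_prox_cluster p np).

Lemma trace_cluster_boundary (p : Xbar) (np : (~` range i) p) :
  coarse_boundary b (trace_cluster p np).
Proof.
move=> A Ap; have : b A A by exists p.
by case/cprox_unbounded.
Qed.

(** The point is the limit given by [cluster_limit].  It lies outside [X] because
[s] has no bounded member, and only one inclusion between [s] and its trace
cluster has to be checked, both being maximal. *)
Lemma boundary_clusterE (s : prox_cluster d) : coarse_boundary b s ->
  exists p (np : (~` range i) p), s = trace_cluster p np.
Proof.
move=> bs; have [p sp] := cluster_limit d s.
have np : (~` range i) p.
  case=> x _ xp; have [V Vx] := bounded_nbhs x.
  by apply: bs; apply: sp; rewrite -xp.
exists p, np; apply: prox_cluster_subset_eq => A sA; split => //.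
apply: closure_of_near_preimages => V oV Vp.
apply: (prox_cluster_near (prox_clusterP s) sA).
by apply: sp; exact: open_nbhs_nbhs.
Qed.

Lemma trace_cluster_inj (p q : Xbar) (np : (~` range i) p)
  (nq : (~` range i) q) : trace_cluster p np = trace_cluster q nq -> p = q.
Proof.
have [_ hXb _ _ _] := ci => e.
apply: (closed_mem_preimages [set q] p) => [|V oV qV].
  by apply: accessible_closed_set1; exact: hausdorff_accessible.
have : trace_cluster p np (i @^-1` V).
  rewrite e; split => //; apply: nbhs_closure_preimage.
  by apply: open_nbhs_nbhs; split => //; exact: qV.
by case.
Qed.

Definition boundary_of_remainder (p : set_type (~` range i)) :
    set_type (coarse_boundary b) :=
  SigSub (mem_set (trace_cluster_boundary (val p) (set_mem (valP p)))).

Lemma boundary_of_remainder_inj : injective boundary_of_remainder.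
Proof.
by move=> p q /(congr1 val) /trace_cluster_inj e; apply: val_inj.
Qed.

Lemma boundary_of_remainder_surj (s : set_type (coarse_boundary b)) :
  exists p, boundary_of_remainder p = s.
Proof.
have [p [np sE]] := boundary_clusterE _ (set_mem (valP s)).
exists (SigSub (mem_set np)); apply: val_inj; rewrite sE.
exact: prox_cluster_ext.
Qed.

Lemma boundary_of_remainder_continuous : continuous boundary_of_remainder.
Proof.
apply: continuous_comp_initial; apply/continuous_closedP => D /prox_closedE cD.
move=> p clp; apply: cD.
suff : @smirnov_near _ d D [set val (boundary_of_remainder p)] by [].
move=> A C DA /(_ _ erefl) Cp; right; exists (val p); split; last exact: Cp.
split; last exact: set_mem (valP p).
(* The closure of [A] contains the preimage of [D], since [A] belongs to all
   clusters in [D]; being closed, it contains the limit point [p] as well. *)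
have cA : closed ((set_val : set_type (~` range i) -> Xbar) @^-1`
    closure (i @` A)).
  apply: preimage_closed => [q _|]; last exact: closed_closure.
  exact: initial_continuous.
suff : ((set_val : set_type (~` range i) -> Xbar) @^-1` closure (i @` A)) p by [].
have /closure_id -> := cA.
by apply: closureS clp => q /DA[].
Qed.

(** By [closed_mem_preimages] the preimages of the open sets including [K] decide
which points of the remainder lie in [K]; so [K] corresponds to an intersection
of closed sets of the kind given by [closed_cluster_mem]. *)
Lemma boundary_of_remainder_inverse_continuous
    (g : set_type (coarse_boundary b) -> set_type (~` range i)) :
  cancel g boundary_of_remainder -> continuous g.
Proof.
move=> gK; apply: continuous_comp_initial; apply/continuous_closedP => K cK.
pose D : set (prox_space (smirnov_proximity d)) :=
  \bigcap_(V in [set V | open V /\ K `<=` V])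
    [set s : prox_cluster d | s (i @^-1` V)].
have cD : closed D by apply: closed_bigI => V _; exact: closed_cluster_mem.
suff -> : (set_val \o g) @^-1` K = set_val @^-1` D.
  by apply: preimage_closed cD => s _; exact: initial_continuous.
apply/seteqP; split=> s /=;
  have -> : set_val s = val (boundary_of_remainder (g s)) by rewrite gK.
  move=> Kg V [oV KV]; split; last exact: set_mem (valP (g s)).
  by apply: nbhs_closure_preimage; apply: open_nbhs_nbhs; split => //; exact: KV.
move=> Ds; apply: closed_mem_preimages => // V oV KV.
by case: (Ds V).
Qed.

End Compactification.

Theorem theorem5p2 (X Xbar : topologicalType) (i : X -> Xbar)
    (lcX : locally_compact [set: X]) (hX : hausdorff_space X)
    (ci : is_compactification i) :
  homeomorphic (set_type (coarse_boundary (trace_coarse_proximity lcX hX ci)))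
               (set_type (~` range i)).
Proof.
pose f := boundary_of_remainder ci lcX hX.
have [g gK] := choice (boundary_of_remainder_surj ci lcX hX).
exists g, f; split.
- exact: gK.
- by move=> p; apply: (boundary_of_remainder_inj ci lcX hX); exact: gK.
- exact: boundary_of_remainder_inverse_continuous gK.
- exact: boundary_of_remainder_continuous.
Qed.
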